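(* Let $A=(a_1\ \cdots\ a_n)$ be a $1\times n$ matrix of positive integers with $n\ge2$ and $a_1<a_2$, which admits a gluing of the first kind in the order $(a_1,\dots,a_n)$. Let $M=\{u_2,\dots,u_n\}$ be a minimal Markov basis for $A$ with $u_k=(u_{k,1},u_{k,2},\dots,u_{k,k-1},-u_{k,k},0,\dots,0)$ for each $k$, where all $u_{k,m}$ are non-negative integers and $u_{k,k}>0$. Then the following are equivalent: (1) $M$ is distance reducing; (2) $M$ reduces the distance of the circuits of $A$; (3) $M$ satisfies condition $R_{i,j}$ for every $2\le i<j\le n$.
   Context: For $z\in\mathbb Z^n$, $z^+,z^-\in\mathbb N^n$ denote the unique vectors with disjoint supports and $z=z^+-z^-$; $\|\cdot\|$ is the $1$-norm. A Markov basis is a set $B\subseteq\ker(A)$ whose binomials $x^{u^+}-x^{u^-}$ generate the toric ideal $I_A=\langle x^{u^+}-x^{u^-}:u\in\ker(A)\rangle$; minimal means no proper subset is a Markov basis. For nonzero $z\in\ker(A)$, $u\in\ker(A)$ reduces the distance of $z$ if there exist $(p,q)\in\{(z^+,z^-),(z^-,z^+)\}$ and $\varepsilon\in\{\pm1\}$ with $p+\varepsilon u\in\mathbb N^n$ and $\|p+\varepsilon u-q\|<\|z\|$; $B$ reduces the distance of $Z$ if each nonzero $z\in Z$ has its distance reduced by some element of $B$; $B$ is distance reducing if it reduces the distance of $\ker(A)$. A circuit is a nonzero element of $\ker(A)$ with support of size exactly two. $A$ admits a gluing of the first kind in the order $(a_1,\dots,a_n)$ if for each $k\in\{1,\dots,n-1\}$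 there is $x\in\mathbb N\{a_1,\dots,a_k\}\cap a_{k+1}\mathbb N$ with $x\mathbb Z=\mathbb Z\{a_1,\dots,a_k\}\cap a_{k+1}\mathbb Z$ (here $\mathbb N X$, $\mathbb ZX$ are the semigroup and group generated by $X$). For $2\le i<j\le n$, $M$ satisfies $R_{i,j}$ if at least one of: (i) $u_{i,1}+\dots+u_{i,i-1}<u_{i,i}$; (ii) there is $\ell\in\{i+1,\dots,j-1\}$ with $u_{\ell,m}=0$ for all $m\in\{1,\dots,\ell-1\}\setminus\{i\}$ and $u_{\ell,i}>u_{\ell,\ell}$; (iii) $\sum_{k=1}^{j}u_{j,k}<2(u_{j,i}+u_{j,j})$. *)

(* Defs.v *)
From HB Require Import structures.
From mathcomp Require Import all_boot all_order all_algebra.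
From mathcomp Require Import mpoly.
Set Implicit Arguments. Unset Strict Implicit. Unset Printing Implicit Defensive.
Import Order.TTheory GRing.Theory Num.Theory.
Local Open Scope ring_scope.

(* Indices are 0-based: paper index k corresponds to the ordinal k-1 : 'I_n.
   Vectors of Z^n are functions 'I_n -> int. *)

Definition vec n := 'I_n -> int.

Definition posp n (z : vec n) : vec n := fun i => Num.max (z i) 0.
Definition negp n (z : vec n) : vec n := fun i => Num.max (- z i) 0.

Definition norm1 n (z : vec n) : int := \sum_(i < n) `|z i|.

Definition inKer n (a : 'I_n -> nat) (z : vec n) : Prop :=
  \sum_(i < n) (a i)%:Z * z i = 0.

Definition mpos n (z : vec n) : 'X_{1..n} := [multinom absz (posp z i) | i < n].
Definition mneg n (z : vec n) : 'X_{1..n} := [multinom absz (negp z i) | i < n].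

Definition binom (K : fieldType) n (z : vec n) : {mpoly K[n]} :=
  'X_[mpos z] - 'X_[mneg z].

Definition gen_ideal (K : fieldType) n (S : {mpoly K[n]} -> Prop)
  (p : {mpoly K[n]}) : Prop :=
  exists s : seq ({mpoly K[n]} * {mpoly K[n]}),
    (forall x, x \in s -> S x.2) /\ p = \sum_(x <- s) x.1 * x.2.

Definition binoms (K : fieldType) n (B : vec n -> Prop) : {mpoly K[n]} -> Prop :=
  fun f => exists u, B u /\ f = @binom K n u.

Definition MarkovBasis (K : fieldType) n (a : 'I_n -> nat) (B : vec n -> Prop) : Prop :=
  (forall u, B u -> inKer a u) /\
  (forall p, @gen_ideal K n (@binoms K n B) p <-> @gen_ideal K n (@binoms K n (inKer a)) p).

Definition minimal_MarkovBasis (K : fieldType) n (a : 'I_n -> nat) (B : vec n -> Prop) : Prop :=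
  @MarkovBasis K n a B /\
  (forall B' : vec n -> Prop, (forall u, B' u -> B u) -> @MarkovBasis K n a B' ->
     forall u, B u -> B' u).

Definition reduces n (u z : vec n) : Prop :=
  exists (b : bool) (e : int), (e = 1 \/ e = -1) /\
    let p := if b then posp z else negp z in
    let q := if b then negp z else posp z in
    (forall i, 0 <= p i + e * u i) /\
    norm1 (fun i => p i + e * u i - q i) < norm1 z.

Definition reduces_set n (B Z : vec n -> Prop) : Prop :=
  forall z, Z z -> z <> (fun _ => 0) -> exists2 u, B u & reduces u z.

Definition distance_reducing n (a : 'I_n -> nat) (B : vec n -> Prop) : Prop :=
  reduces_set B (inKer a).

Definition circuit n (a : 'I_n -> nat) (z : vec n) : Prop :=
  inKer a z /\ #|[pred i | z i != 0]| = 2%N.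

(* ---- gluing of the first kind in the order (a_1,...,a_n) ----
   for each paper index k in 1..n-1, i.e. ordinal k' = k (0-based index of a_{k+1}),
   there is x in N{a_1..a_k} ∩ a_{k+1}N with xZ = Z{a_1..a_k} ∩ a_{k+1}Z. *)
Definition gluing_first_kind n (a : 'I_n -> nat) : Prop :=
  forall k : 'I_n, (0 < k)%N ->
    exists x : nat,
      (exists l : 'I_n -> nat, x = (\sum_(i < n | (i < k)%N) l i * a i)%N) /\
      (exists t : nat, x = (a k * t)%N) /\
      (forall y : int,
         (exists t : int, y = x%:Z * t) <->
         ((exists m : 'I_n -> int, y = \sum_(i < n | (i < k)%N) m i * (a i)%:Z) /\
          (exists t : int, y = (a k)%:Z * t))).

(* ---- the vectors u_k built from the non-negative entries c k m = u_{k,m} ----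
   u_k = (u_{k,1},...,u_{k,k-1}, -u_{k,k}, 0, ..., 0) *)
Definition uvec n (c : 'I_n -> 'I_n -> nat) (k : 'I_n) : vec n :=
  fun m => if (m < k)%N then (c k m)%:Z
           else if m == k then - (c k k)%:Z else 0.

Definition Mset n (c : 'I_n -> 'I_n -> nat) : vec n -> Prop :=
  fun v => exists2 k : 'I_n, (0 < k)%N & v = uvec c k.

Definition R_cond n (c : 'I_n -> 'I_n -> nat) (i j : 'I_n) : Prop :=
  (\sum_(m < n | (m < i)%N) c i m < c i i)%N
  \/ (exists l : 'I_n, [/\ (i < l)%N, (l < j)%N,
        (forall m : 'I_n, (m < l)%N -> m != i -> c l m = 0%N)
        & (c l l < c l i)%N])
  \/ (\sum_(m < n | (m <= j)%N) c j m < 2 * (c j i + c j j))%N.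

(* Main.v *)
(** Since the binomials of [M] generate the toric ideal, [M] spans [ker A] over
    the integers, so every kernel vector is [z = sum_k x_k u_k].

    (3) => (1): let [j] be the last index with [x_j != 0]; up to sign [x_j > 0],
    hence [u_j] may be added to [z^-].  Let [k < j] be the last index with
    [x_k < 0], or the first index if there is none.  All [x_m] with [m > k] are
    nonnegative, so [z_k] is at least each of its terms [x_m u_{m,k}].
    According to the clause of [R_{k,j}] that holds, [u_k] reduces [z] (i),
    [u_j] reduces [z] (iii), or a vector [u_l] supported on [{k, l}] does
    provided [x_l > 0] (ii).  If [x_l = 0], repeat the argument at [l]: clause
    (i) fails there, so the search climbs and must end.  The first index needs
    no hypothesis because [a_1 < a_2] makes [u_2] such a vector [u_l].

    (2) => (3): if [u_k] reduces a vector supported on [{i, j}], the triangle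
    inequality gives [|u_k| < 2 (|u_{k,i}| + |u_{k,j}|)].  For [k = i], [k = j]
    or [k < j] this is [R_{i,j}].  If [k > j], then [u_k] is a climbing vector
    from [i] or from [j]; taking [k] minimal, [R_{j,k}] respectively [R_{i,k}],
    known by descending induction on [j], forces [R_{i,j}]. *)

Require Import Defs.
From HB Require Import structures.
From mathcomp Require Import all_boot all_order all_algebra.
From mathcomp Require Import ssrcomplements mpoly.
From mathcomp Require Import zify.
From Stdlib Require Import ClassicalEpsilon FunctionalExtensionality.
Import Order.TTheory GRing.Theory Num.Theory.
Set Implicit Arguments. Unset Strict Implicit. Unset Printing Implicit Defensive.
Local Open Scope ring_scope.

(** * Linear functionals on polynomials, given by their values on monomials *)

Section CoefficientFunctional.
Variables (K : fieldType) (n : nat) (F : 'X_{1..n} -> K).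

Definition coef_sum (p : {mpoly K[n]}) : K := \sum_(m <- msupp p) p@_m * F m.

(** A degree bound gives several polynomials a common index set; additivity follows termwise. *)
Lemma coef_sumEw d (p : {mpoly K[n]}) : (msize p <= d)%N ->
  coef_sum p = \sum_(m : 'X_{1..n < d}) p@_m * F m.
Proof.
move=> le_pd; rewrite /coef_sum.
rewrite (big_mksub 'X_{1..n < d}) /= ?msupp_uniq //; last first.
  by move=> m mp; rewrite (leq_trans (msize_mdeg_lt mp)).
rewrite big_rmcond //= => m /memN_msupp_eq0 ->; exact: mul0r.
Qed.

Lemma coef_sumD : {morph coef_sum : p q / p + q}.
Proof.
move=> p q; set d := maxn (msize p) (msize q).
rewrite (@coef_sumEw d) ?msizeD_le // (@coef_sumEw d p) ?leq_maxl //.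
rewrite (@coef_sumEw d q) ?leq_maxr // -big_split /=.
by apply: eq_bigr => m _; rewrite mcoeffD mulrDl.
Qed.

Lemma coef_sum0 : coef_sum 0 = 0.
Proof. by rewrite /coef_sum msupp0 big_nil. Qed.

Lemma coef_sumZX k m : coef_sum (k *: 'X_[m]) = k * F m.
Proof.
have [->|k0] := eqVneq k 0; first by rewrite scale0r coef_sum0 mul0r.
by rewrite /coef_sum msuppMCX // big_seq1 mcoeffZ mcoeffX eqxx mulr1.
Qed.

Lemma coef_sumZ_sub k m1 m2 :
  coef_sum (k *: ('X_[m1] - 'X_[m2])) = k * (F m1 - F m2).
Proof. by rewrite scalerBr -scaleNr coef_sumD !coef_sumZX mulNr mulrBr. Qed.

End CoefficientFunctional.

(** * From generators of the toric ideal to generators of the lattice *)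

Lemma posp_sub_negp n (z : vec n) i : posp z i - negp z i = z i.
Proof. rewrite /posp /negp; lia. Qed.

Lemma mpos_sub_mneg n (z : vec n) i : (mpos z i)%:Z - (mneg z i)%:Z = z i.
Proof. rewrite !mnmE /posp /negp; lia. Qed.

(* Modulo a sublattice [L] containing [B], each binomial of [B] has both its
   monomials in one class, so the coefficients of an element of the ideal sum
   to zero over every class of monomials. *)
Lemma binom_in_ideal_lattice (K : fieldType) n (B L : vec n -> Prop) (z : vec n) :
  (forall x y, x =1 y -> L x -> L y) ->
  L (fun=> 0) ->
  (forall x y, L x -> L y -> L (fun i => x i + y i)) ->
  (forall x, L x -> L (fun i => - x i)) ->
  (forall u, B u -> L u) ->
  @gen_ideal K n (@binoms K n B) (@binom K n z) -> L z.
Proof.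
move=> Lext L0 LD LN BL [s [sB def_z]].
(* [F] is the indicator of the class of $z^-$ modulo [L]. *)
pose cls (m : 'X_{1..n}) := L (fun i => (m i)%:Z - (mneg z i)%:Z).
pose F m : K := if excluded_middle_informative (cls m) then 1 else 0.
have FE m1 m2 : (cls m1 <-> cls m2) -> F m1 = F m2.
  move=> E; rewrite /F; case: excluded_middle_informative => h1;
    case: excluded_middle_informative => h2 //; [case: h2 | case: h1]; exact/E.
have Fu m (u : vec n) : B u -> F (m + mpos u)%MM = F (m + mneg u)%MM.
  move=> /BL Lu; apply: FE; split => h.
    apply: Lext (LD _ _ h (LN _ Lu)) => i /=.
    have := mpos_sub_mneg u i; rewrite !mnmDE; lia.
  apply: Lext (LD _ _ h Lu) => i /=.
  have := mpos_sub_mneg u i; rewrite !mnmDE; lia.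
have : coef_sum F (binom K z) = 0.
  rewrite def_z (big_morph _ (coef_sumD F) (coef_sum0 F)) big_seq big1 // => x.
  case/sB => u [Bu ->]; rewrite {1}[x.1]mpolyE mulr_suml.
  rewrite (big_morph _ (coef_sumD F) (coef_sum0 F)) big1 // => m _.
  rewrite /binom -scalerAl mulrBr -!mpolyXD coef_sumZ_sub Fu // subrr.
  exact: mulr0.
(* Since $F(z^-)=1$, the functional vanishes on the binomial of $z$ only if $z^+$ lies in the same
   class, that is, if $z\in L$. *)
rewrite /binom -[X in coef_sum _ X]scale1r coef_sumZ_sub mul1r /F.
case: excluded_middle_informative => [h|Nh]; first move=> _.
  by apply: Lext h => i; rewrite mpos_sub_mneg.
case: excluded_middle_informative => [h|[]].
  by rewrite sub0r => /eqP; rewrite oppr_eq0 oner_eq0.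
by apply: Lext L0 => i; rewrite subrr.
Qed.

(** The preceding lemma is applied to the integer span of [Mset c]. The coefficient at the first
    index is set to 0 because [Mset c] takes no vector from that index. *)
Lemma inKer_uvec_span (K : fieldType) n (a : 'I_n -> nat) (c : 'I_n -> 'I_n -> nat) :
  @MarkovBasis K n a (Mset c) -> forall z, inKer a z ->
  exists x : 'I_n -> int, (forall k : 'I_n, val k = 0%N -> x k = 0) /\
    forall m, z m = \sum_k x k * uvec c k m.
Proof.
move=> [_ idealE] z kz.
pose L (z : vec n) := exists x : 'I_n -> int,
  (forall k : 'I_n, val k = 0%N -> x k = 0) /\
  forall m, z m = \sum_k x k * uvec c k m.
apply: (@binom_in_ideal_lattice K n (Mset c) L); rewrite {}/L.
- by move=> v w vw [x [x0 xE]]; exists x; split=> // m; rewrite -vw.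
- exists (fun=> 0); split=> // m; rewrite big1 // => k _; exact: mul0r.
- move=> v w [x [x0 xE]] [y [y0 yE]]; exists (fun k => x k + y k); split.
    by move=> k k0; rewrite x0 // y0.
  by move=> m; rewrite xE yE -big_split; apply: eq_bigr => k _; rewrite mulrDl.
- move=> v [x [x0 xE]]; exists (fun k => - x k); split.
    by move=> k k0; rewrite x0 // oppr0.
  by move=> m; rewrite xE -sumrN; apply: eq_bigr => k _; rewrite mulNr.
- move=> _ [k k0 ->]; exists (fun l => (l == k)%:R); split.
    by move=> l l0; case: eqP => // lk; rewrite -lk l0 in k0.
  move=> m; rewrite (bigD1 k) //= eqxx mul1r big1 ?addr0 // => l /negPf ->.
  exact: mul0r.
apply/idealE; exists [:: (1, binom K z)]; split; last by rewrite big_seq1 mul1r.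
by move=> x; rewrite inE => /eqP ->; exists z.
Qed.

(** * Norm estimates and criteria for reducing the distance *)

Lemma norm1D_le n (z u w : vec n) (S : pred 'I_n) :
  (forall i, `|z i| + `|u i| <= `|w i| + (if S i then `|u i| *+ 2 else 0)) ->
  norm1 z + norm1 u <= norm1 w + (\sum_(i | S i) `|u i|) *+ 2.
Proof.
move=> le_w; rewrite /norm1 -sumrMnl [X in _ <= _ + X]big_mkcond -!big_split /=.
exact: ler_sum.
Qed.

(** On [S] the entries cancel, so $|z_i+u_i|=|z_i|-|u_i|$; elsewhere $|z_i+u_i|\le|z_i|+|u_i|$. The
    norm drops once [S] carries more than half of $\|u\|$. *)
Lemma norm1D_lt n (z u : vec n) (S : pred 'I_n) :
  (forall i, S i -> z i * u i <= 0 /\ `|u i| <= `|z i|) ->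
  norm1 u < (\sum_(i | S i) `|u i|) *+ 2 ->
  norm1 (fun i => z i + u i) < norm1 z.
Proof.
move=> cancelS lt_u.
pose w : vec n := fun i => z i + u i.
suff : norm1 w - norm1 u + (\sum_(i | S i) `|u i|) *+ 2 <= norm1 z.
  by rewrite -/w; lia.
rewrite /norm1 -sumrMnl -sumrB [X in _ + X]big_mkcond -big_split /=.
apply: ler_sum => i _; rewrite /w; case: ifP => [/cancelS []|_]; last by lia.
case: (lerP 0 (z i)) => zi; case: (lerP 0 (u i)) => ui; nia.
Qed.

(** Off [S] the sum is just $u$; on [S] the triangle inequality gives $|z_i|\le|z_i+u_i|+|u_i|$. *)
Lemma norm1D_lt_inv n (z u : vec n) (S : pred 'I_n) :
  (forall i, ~~ S i -> z i = 0) ->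
  norm1 (fun i => z i + u i) < norm1 z ->
  norm1 u < (\sum_(i | S i) `|u i|) *+ 2.
Proof.
move=> zS.
suff : norm1 z + norm1 u <=
   norm1 (fun i => z i + u i) + (\sum_(i | S i) `|u i|) *+ 2 by lia.
apply: norm1D_le => i; case: ifP => [_|/negbT /zS ->]; lia.
Qed.

Lemma norm1N n (z : vec n) : norm1 (fun i => - z i) = norm1 z.
Proof. by apply: eq_bigr => i _; rewrite normrN. Qed.

Lemma reduces_opp n (u z : vec n) : reduces u (fun i => - z i) -> reduces u z.
Proof.
case=> b [e [e1 [ge0 lt_z]]]; exists (~~ b), e; split=> //.
have pN : posp (fun i => - z i) =1 negp z by move=> i; rewrite /posp /negp.
have nN : negp (fun i => - z i) =1 posp z.
  by move=> i; rewrite /posp /negp opprK.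
rewrite norm1N in lt_z; case: b ge0 lt_z => /= ge0 lt_z; split.
- by move=> i; rewrite -pN.
- rewrite (_ : norm1 _ = norm1 (fun i => posp (fun i => - z i) i + e * u i -
    negp (fun i => - z i) i)) //; apply: eq_bigr => i _; by rewrite pN nN.
- by move=> i; rewrite -nN.
rewrite (_ : norm1 _ = norm1 (fun i => negp (fun i => - z i) i + e * u i -
    posp (fun i => - z i) i)) //; apply: eq_bigr => i _; by rewrite pN nN.
Qed.

(** Moving $z^-$ by $eu$ changes $z=z^+-z^-$ by $-eu$. Measuring the sign relative to $z$ gives both
    choices of $p$ the same norm condition. *)
Lemma reducesP n (u z : vec n) : reduces u z <->
  exists2 e : int, e = 1 \/ e = -1 &
    norm1 (fun i => z i + e * u i) < norm1 z /\
    ((forall i, 0 <= posp z i + e * u i) \/ (forall i, 0 <= negp z i - e * u i)).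
Proof.
have posE e : norm1 (fun i => posp z i + e * u i - negp z i) =
    norm1 (fun i => z i + e * u i).
  by apply: eq_bigr => i _; rewrite -[in RHS](posp_sub_negp z) addrAC.
have negE e : norm1 (fun i => negp z i + e * u i - posp z i) =
    norm1 (fun i => z i + - e * u i).
  apply: eq_bigr => i _.
  by rewrite -normrN mulNr opprB opprD addrA posp_sub_negp.
have sgnN (e : int) : e = 1 \/ e = -1 -> - e = 1 \/ - e = -1.
  by case=> ->; [right | left; rewrite opprK].
split=> [[[] [e [e1 /= [ge0 lt_z]]]]|[e e1 [lt_z [ge0|ge0]]]].
- by exists e; rewrite // -posE; split=> //; left.
- exists (- e); first exact: sgnN.
  by rewrite -negE; split=> //; right=> i; rewrite mulNr opprK.
- by exists true, e; split=> //=; rewrite posE.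
exists false, (- e); split; first exact: sgnN.
by rewrite /= negE opprK; split=> // i; rewrite mulNr.
Qed.

Lemma reduces_cancel n (u z : vec n) (e : int) (S : pred 'I_n) :
  (e = 1 \/ e = -1) ->
  (forall i, 0 <= posp z i + e * u i) \/ (forall i, 0 <= negp z i - e * u i) ->
  (forall i, S i -> z i * (e * u i) <= 0 /\ `|u i| <= `|z i|) ->
  norm1 u < (\sum_(i | S i) `|u i|) *+ 2 -> reduces u z.
Proof.
move=> e1 ge0 cancelS lt_u; apply/reducesP; exists e => //; split=> //.
have eN i : `|e * u i| = `|u i| by case: e1 => ->; rewrite ?mul1r ?mulN1r ?normrN.
apply: (@norm1D_lt _ _ _ S) => [i /cancelS|]; rewrite ?eN //.
by rewrite /norm1 !(eq_bigr _ (fun i _ => eN i)).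
Qed.

Lemma big_pred2 (I : finType) (V : zmodType) (i j : I) (F : I -> V) : i != j ->
  \sum_(k | pred2 i j k) F k = F i + F j.
Proof.
move=> ij; rewrite (bigD1 i) /= ?eqxx // (big_pred1 j) // => k.
by case: eqVneq => [->|_]; rewrite /= ?(negPf ij) ?andbT.
Qed.

(** * Triangular vectors and the three clauses of $R_{i,j}$ *)

Section Triangular.
Variables (n : nat) (c : 'I_n -> 'I_n -> nat).

Local Notation u := (uvec c).
Implicit Types i j k l m : 'I_n.

Definition contracting (i : 'I_n) := (\sum_(m < n | (m < i)%N) c i m < c i i)%N.

(* Condition (ii): [u l] is supported on [i] and [l] and trades [c l i] units
   at [i] for fewer units at [l]. *)
Definition climbs (i l : 'I_n) : bool :=
  [&& (i < l)%N, [forall m : 'I_n, ((m < l)%N && (m != i)) ==> (c l m == 0%N)]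
    & (c l l < c l i)%N].

Definition dominant (i j : 'I_n) :=
  (\sum_(m < n | (m <= j)%N) c j m < 2 * (c j i + c j j))%N.

Lemma R_condP (i j : 'I_n) : R_cond c i j <->
  [\/ contracting i, exists2 l, climbs i l & (l < j)%N | dominant i j].
Proof.
split.
  case=> [|[[l [il lj cl0 cl]]|]]; [by constructor 1| |by constructor 3].
  constructor 2; exists l => //; apply/and3P; split=> //.
  by apply/forallP => m; apply/implyP => /andP [ml mi]; rewrite cl0.
case=> [h|[l /and3P [il cl0 cl] lj]|h]; [by left| |by right; right].
right; left; exists l; split=> // m ml mi; apply/eqP.
by have /implyP -> := forallP cl0 m; rewrite ?ml.
Qed.

Lemma abs_uvec k m : `|u k m| = (if (m <= k)%N then c k m else 0%N)%:Z.
Proof.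
rewrite /uvec; case: ltngtP => [mk|mk|/val_inj ->].
- by [].
- by rewrite ifN ?normr0 // neq_ltn mk orbT.
- by rewrite eqxx normrN.
Qed.

Lemma norm1_uvec k : norm1 (u k) = (\sum_(m < n | (m <= k)%N) c k m)%N%:Z.
Proof.
rewrite (big_morph Posz PoszD (erefl _)) big_mkcond /norm1.
by apply: eq_bigr => m _; rewrite abs_uvec; case: ifP.
Qed.

Lemma sum_leq_split k : (\sum_(m < n | (m <= k)%N) c k m =
  \sum_(m < n | (m < k)%N) c k m + c k k)%N.
Proof.
rewrite (bigD1 k) //= addnC; congr addn; apply: eq_bigl => m.
by rewrite ltn_neqAle andbC.
Qed.

Lemma climbs_sum i l : climbs i l ->
  (\sum_(m < n | (m <= l)%N) c l m = c l i + c l l)%N.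
Proof.
case/and3P => il /forallP cl0 _; rewrite sum_leq_split (bigD1 i) //= big1 ?addn0 //.
by move=> m mi; apply/eqP; have /implyP -> := cl0 m.
Qed.

Lemma climbs_Ncontracting i l : climbs i l -> ~ contracting l.
Proof.
move=> il; have := climbs_sum il; rewrite sum_leq_split /contracting.
case/and3P: il; lia.
Qed.

Lemma uvec_lt k (m : 'I_n) : (m < k)%N -> u k m = (c k m)%:Z.
Proof. by rewrite /uvec => ->. Qed.

Lemma uvec_eq k : u k k = - (c k k)%:Z.
Proof. by rewrite /uvec ltnn eqxx. Qed.

Lemma uvec_gt k (m : 'I_n) : (k < m)%N -> u k m = 0.
Proof. by move=> km; rewrite /uvec ltnNge (ltnW km) /= ifN // neq_ltn km orbT. Qed.

Lemma uvec_climbs i l m : climbs i l -> m != i -> m != l -> u l m = 0.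
Proof.
case/and3P => il /forallP cl0 _ mi ml; case: (ltngtP m l) => [lt|gt|/val_inj E].
- by rewrite uvec_lt // (eqP (implyP (cl0 m) _)) // lt.
- exact: uvec_gt.
- by rewrite E eqxx in ml.
Qed.


(** * Reductions of an integer combination of the triangular vectors *)

Section Combination.
Variables (x : 'I_n -> int) (z : vec n).
Hypothesis zE : forall m, z m = \sum_k x k * u k m.

(** Every summand of $z_i$ is nonnegative: those before [i] vanish, those after have $x_k\ge0$ and a
    nonnegative entry, and the one at [i] is $-x_iu_{i,i}$. So $z_i$ bounds each of them. *)
Lemma coord_ge_term i l : x i <= 0 -> (forall m, (i < m)%N -> 0 <= x m) ->
  x l * u l i <= z i.
Proof.
move=> xi0 xge0; rewrite zE (bigD1 l) //= lerDl sumr_ge0 // => k _.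
case: (ltngtP k i) => [ki|ik|/val_inj ->].
- by rewrite uvec_gt // mulr0.
- by rewrite uvec_lt // mulr_ge0 // xge0.
- by rewrite uvec_eq mulrN -mulNr mulr_ge0 // oppr_ge0.
Qed.

Lemma coord_top j : (forall m, (j < m)%N -> x m = 0) -> z j = - (x j * (c j j)%:Z).
Proof.
move=> xj0; rewrite zE (bigD1 j) //= uvec_eq mulrN big1 ?addr0 // => k kj.
have [kj'|jk] := ltnP k j; first by rewrite uvec_gt // mulr0.
by rewrite xj0 ?mul0r // ltn_neqAle jk andbT eq_sym.
Qed.

Lemma contracting_reduces i : contracting i -> (c i i)%:Z <= z i -> reduces (u i) z.
Proof.
move=> ci zi; apply: (@reduces_cancel _ _ _ 1 (pred1 i)); first by left.
- left=> m; rewrite mul1r; case: (ltngtP m i) => [mi|mi|/val_inj ->].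
  + rewrite uvec_lt // /posp; lia.
  + rewrite uvec_gt // /posp; lia.
  + rewrite uvec_eq /posp; lia.
- move=> m /eqP ->; rewrite uvec_eq; split; nia.
rewrite (big_pred1 i) // norm1_uvec sum_leq_split uvec_eq.
rewrite /contracting in ci; lia.
Qed.

Lemma climbs_reduces i l : climbs i l -> (c l i)%:Z <= z i -> reduces (u l) z.
Proof.
move=> cil zi; have [il _ lt_l] := and3P cil.
(* The vector is subtracted from $z^+$, which loses only at [i]. *)
apply: (@reduces_cancel _ _ _ (-1) (pred1 i)); first by right.
- left=> m; rewrite mulN1r; have [->|mi] := eqVneq m i.
    rewrite uvec_lt // /posp; lia.
  have [->|ml] := eqVneq m l; first by rewrite uvec_eq /posp; lia.
  by rewrite (uvec_climbs cil) // /posp; lia.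
- move=> m /eqP ->; rewrite uvec_lt //; split; nia.
rewrite (big_pred1 i) // norm1_uvec (climbs_sum cil) uvec_lt //; lia.
Qed.

Lemma dominant_reduces i j : (i < j)%N -> dominant i j ->
  (c j i)%:Z <= z i -> z j <= - (c j j)%:Z -> reduces (u j) z.
Proof.
move=> ij dij zi zj.
have nij : i != j by rewrite neq_ltn ij.
(* Here $u_j$ is added to $z^-$, and cancellation takes place at both [i] and [j]. *)
apply: (@reduces_cancel _ _ _ (-1) (pred2 i j)); first by right.
- right=> m; rewrite mulN1r; case: (ltngtP m j) => [mj|mj|/val_inj ->].
  + rewrite uvec_lt // /negp; lia.
  + rewrite uvec_gt // /negp; lia.
  + rewrite uvec_eq /negp; lia.
- move=> m /orP [] /eqP ->; first by rewrite uvec_lt //; split; nia.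
  by rewrite uvec_eq; split; nia.
rewrite big_pred2 // norm1_uvec uvec_lt // uvec_eq.
rewrite /dominant in dij; lia.
Qed.

(* Either the climbing vector [u l] occurs in [z] and can be subtracted, or
   [x l = 0] and the search moves up to [l], which is not contracting. *)
Lemma climb_to_reduction i j : (i < j)%N -> 0 < x j -> (forall m, (j < m)%N -> x m = 0) ->
  (forall k, (0 < k)%N -> (k < j)%N -> R_cond c k j) ->
  x i <= 0 -> (forall m, (i < m)%N -> 0 <= x m) ->
  (exists2 l, climbs i l & (l < j)%N) \/ dominant i j ->
  exists2 v, Mset c v & reduces v z.
Proof.
(* Induction on $j-i$: the search index increases and stays below [j]. *)
move=> ij xj xgt Rj; have [d] := ubnP (j - i)%N.
elim: d i ij => // d IHd i ij led xi xge0 [[l cil lj]|dij].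
  have il : (i < l)%N by case/and3P: cil.
  have [xl|xl] := lerP (x l) 0; last first.
    exists (u l); first by exists l => //; lia.
    apply: climbs_reduces cil _; have := coord_ge_term l xi xge0.
    rewrite uvec_lt //; nia.
  apply: (IHd l) => //; first by lia.
    by move=> m lm; apply: xge0; lia.
  have /R_condP [/(climbs_Ncontracting cil)//|h|h] : R_cond c l j by apply: Rj => //; lia.
    by left.
  by right.
exists (u j); first by exists j => //; lia.
apply: dominant_reduces dij _ _ => //.
  by have := coord_ge_term j xi xge0; rewrite uvec_lt //; nia.
by rewrite coord_top //; nia.
Qed.

End Combination.

End Triangular.

(** * The conditions $R_{i,j}$ imply distance reduction *)

(** At the first index clause (i) would call for a vector that [Mset c] does not supply, so the
    second hypothesis asks there for one of the other two clauses. *)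
Lemma R_cond_distance_reducing n (a : 'I_n -> nat) (c : 'I_n -> 'I_n -> nat) :
  (forall z, inKer a z -> exists x : 'I_n -> int,
     (forall k : 'I_n, val k = 0%N -> x k = 0) /\
     forall m, z m = \sum_k x k * uvec c k m) ->
  (forall i j : 'I_n, val i = 0%N -> (0 < j)%N ->
     (exists2 l, climbs c i l & (l < j)%N) \/ dominant c i j) ->
  (forall i j : 'I_n, (0 < i)%N -> (i < j)%N -> R_cond c i j) ->
  distance_reducing a (Mset c).
Proof.
move=> span R0 R z /span [x [x0 zE]] z0.
have [j0 xj0] : exists j, x j != 0.
  apply/existsP; apply: contra_notT z0 => /existsPn x_eq0.
  apply: functional_extensionality => m; rewrite zE big1 // => k _.
  by have /negbNE/eqP -> := x_eq0 k; rewrite mul0r.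
have [j xj top] := @arg_maxnP _ j0 (fun j => x j != 0) (fun j => val j) xj0.
have xgt (m : 'I_n) : (j < m)%N -> x m = 0.
  by move=> jm; apply/eqP; apply: contraLR jm => /top; rewrite -leqNgt.
have j_gt0 : (0 < j)%N by rewrite lt0n; apply: contra_neqN xj => /eqP /x0.
wlog xjp : x z zE x0 z0 xj xgt {xj0 top} / 0 < x j.
  move=> red; have [|xjn] := ltrP 0 (x j); first exact: red.
  have [|||||| v Mv rv] := red (fun k => - x k) (fun m => - z m).
  - by move=> m; rewrite zE -sumrN; apply: eq_bigr => k _; rewrite mulNr.
  - by move=> k k0; rewrite x0 ?oppr0.
  - move=> zN; apply: z0; apply: functional_extensionality => m.
    by apply/eqP; rewrite -oppr_eq0; apply/eqP; exact: (congr1 (fun f => f m) zN).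
  - by rewrite oppr_eq0.
  - by move=> m /xgt ->; rewrite oppr0.
  - by lia.
  by exists v => //; apply: reduces_opp.
(* The first index starts the search when no coefficient is negative; its own coefficient is 0. *)
pose o : 'I_n := Ordinal (leq_ltn_trans (leq0n j) (ltn_ord j)).
have [/existsP [k0 xk0]|/existsPn xN] := boolP [exists k, x k < 0]; last first.
  apply: (climb_to_reduction zE (i := o)) xjp _ _ _ _ _ => //.
  - by move=> k k0 kj; apply: R.
  - by rewrite x0.
  - by move=> m _; rewrite leNgt xN.
  - exact: R0.
have [k xk kmax] := @arg_maxnP _ k0 (fun j => x j < 0) (fun j => val j) xk0.
have xge0 (m : 'I_n) : (k < m)%N -> 0 <= x m.
  by move=> km; rewrite leNgt; apply: contraL km => /kmax; rewrite -leqNgt.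
have k_gt0 : (0 < k)%N by rewrite lt0n; apply/eqP => /x0 xk_eq0; rewrite xk_eq0 in xk.
have kj : (k < j)%N.
  case: (ltngtP k j) => [//|/xgt|/val_inj Ekj]; first by lia.
  by move: xk; rewrite Ekj; lia.
have /R_condP [ck|h|h] := R k j k_gt0 kj.
- exists (uvec c k); first by exists k.
  apply: contracting_reduces ck _.
  have := coord_ge_term zE k (ltW xk) xge0; rewrite uvec_eq; nia.
- apply: (climb_to_reduction zE kj xjp xgt) => //; [|exact: ltW|by left].
  by move=> i i0 ij; apply: R.
- apply: (climb_to_reduction zE kj xjp xgt) => //; [|exact: ltW|by right].
  by move=> i i0 ij; apply: R.
Qed.

(** The kernel relation reads $a_iu_{l,i}=a_lu_{l,l}$, so $a_i<a_l$ forces $u_{l,i}>u_{l,l}$. *)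
Lemma climbs_first n (a : 'I_n -> nat) (c : 'I_n -> 'I_n -> nat) (i l : 'I_n) :
  val i = 0%N -> val l = 1%N -> (0 < a i)%N -> (a i < a l)%N -> (0 < c l l)%N ->
  inKer a (uvec c l) -> climbs c i l.
Proof.
move=> i0 l1 ai ail cl; have il : (i < l)%N by rewrite i0 l1.
have nil : i != l by rewrite neq_ltn il.
have m_lt1 (m : 'I_n) : (m < l)%N -> m = i.
  by rewrite l1 ltnS leqn0 => /eqP m0; apply: val_inj; rewrite i0.
rewrite /inKer (bigD1 i) //= (bigD1 l) 1?eq_sym //= big1 => [|m /andP [mi ml]].
  rewrite uvec_lt // uvec_eq => ker0; apply/and3P; split=> //; last by nia.
  by apply/forallP => m; apply/implyP => /andP [/m_lt1 ->]; rewrite eqxx.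
case: (ltngtP m l) => [/m_lt1 E|lm|/val_inj E]; last by rewrite E eqxx in ml.
  by rewrite E eqxx in mi.
by rewrite uvec_gt // mulr0.
Qed.

Lemma climbs_dominant n (c : 'I_n -> 'I_n -> nat) (i j : 'I_n) :
  (0 < c j j)%N -> climbs c i j -> dominant c i j.
Proof. by move=> cj /climbs_sum; rewrite /dominant; lia. Qed.

(** * Reducing the circuits implies the conditions $R_{i,j}$ *)

(** Division by $\gcd(a_i,a_j)$ is omitted: [circuit] constrains only the size of the support. *)
Definition elementary_circuit n (a : 'I_n -> nat) (i j : 'I_n) : vec n :=
  fun m => if m == i then (a j)%:Z else if m == j then - (a i)%:Z else 0.

Lemma elementary_circuitP n (a : 'I_n -> nat) (i j : 'I_n) :
  i != j -> (0 < a i)%N -> (0 < a j)%N -> circuit a (elementary_circuit a i j).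
Proof.
move=> ij ai aj; split.
  rewrite /inKer (bigD1 i) //= (bigD1 j) 1?eq_sym //= big1 => [|m /andP [mi mj]].
    by rewrite /elementary_circuit [j == i]eq_sym (negPf ij) !eqxx; lia.
  by rewrite /elementary_circuit (negPf mi) (negPf mj) mulr0.
rewrite -(_ : #|pred2 i j| = 2%N); last by rewrite card2 ij.
apply: eq_card => m; rewrite !inE /elementary_circuit.
have [_|_] := eqVneq m i; first by rewrite /=; lia.
by have [_|_] := eqVneq m j; rewrite /= ?eqxx //; lia.
Qed.

(** One circuit on $\{i,j\}$ is tested. If $u_k$ reduces it, then $k=i$, $k=j$ and the other $k<j$
    give clauses (i), (iii) and (ii); the case $k>j$ is left as the second alternative. *)
Lemma circuit_reduced_R_cond n (a : 'I_n -> nat) (c : 'I_n -> 'I_n -> nat) (i j : 'I_n) :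
  (forall i, 0 < a i)%N -> (forall k : 'I_n, (0 < k)%N -> (0 < c k k)%N) ->
  reduces_set (Mset c) (circuit a) -> (i < j)%N ->
  R_cond c i j \/ exists k : 'I_n, (j < k)%N && (climbs c i k || climbs c j k).
Proof.
move=> apos cpos red ij; have nij : i != j by rewrite neq_ltn ij.
set z := elementary_circuit a i j.
have [||_ [k k0 ->] /reducesP [e e1 [lt_z ge0]]] := red z.
- exact: elementary_circuitP.
- move=> /(congr1 (fun f => f i)); rewrite /z /elementary_circuit eqxx.
  by have := apos j; lia.
have zN m : ~~ pred2 i j m -> z m = 0.
  by rewrite /= negb_or /z /elementary_circuit => /andP [/negPf -> /negPf ->].
have eN m : `|e * uvec c k m| = `|uvec c k m|.
  by case: e1 => ->; rewrite ?mul1r ?mulN1r ?normrN.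
have := norm1D_lt_inv zN lt_z.
rewrite {1}/norm1 !(eq_bigr _ (fun m _ => eN m)) -/(norm1 _) norm1_uvec big_pred2 //.
rewrite !abs_uvec => lt_u.
have [Eki|nki] := eqVneq k i.
  left; apply/R_condP; constructor 1; move: lt_u; rewrite Eki sum_leq_split leqnn.
  by rewrite leqNgt ij /contracting addr0; lia.
have [Ekj|nkj] := eqVneq k j.
  left; apply/R_condP; constructor 3; move: lt_u; rewrite Ekj leqnn (ltnW ij) /dominant.
  by lia.
(* [u k] moves [posp z] or [negp z], a multiple of [e_i] or of [e_j]; since
   neither has a coordinate at [k], the move subtracts [u k], whose positive
   part is then supported on that single index [s]. *)
have [s sij s0] : exists2 s, pred2 i j s &
    forall m : 'I_n, (m < k)%N -> m != s -> c k m = 0%N.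
  have zk : z k = 0 by apply: zN; rewrite /= negb_or nki.
  have ck := cpos k k0.
  case: ge0 => ge0; [exists i | exists j]; rewrite /= ?eqxx ?orbT // => m mk ms.
    have eE : e = -1.
      by move: (ge0 k); rewrite /posp zk uvec_eq; case: e1 => ->; lia.
    move: (ge0 m); rewrite uvec_lt // eE /posp /z /elementary_circuit (negPf ms).
    by case: ifP; lia.
  have eE : e = 1.
    by move: (ge0 k); rewrite /negp zk uvec_eq; case: e1 => ->; lia.
  move: (ge0 m); rewrite uvec_lt // eE /negp /z /elementary_circuit (negPf ms).
  by case: ifP; lia.
have lt_s : (\sum_(m < n | (m <= k)%N) c k m < 2 * (if (s <= k)%N then c k s else 0))%N.
  have sub0 m : m != k -> m != s -> (if (m <= k)%N then c k m else 0%N)%:Z = 0.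
    by move=> mk ms; case: ifP => // le_mk; rewrite s0 // ltn_neqAle mk.
  case/orP: sij => /eqP Es; move: lt_u.
    by rewrite (sub0 j) ?Es // 1?eq_sym // addr0; lia.
  by rewrite (sub0 i) ?Es // 1?eq_sym // add0r; lia.
(* For $s>k$ the right side of [lt_s] would be 0, and $s=k$ is excluded by $k\ne i,j$. *)
have sk : (s < k)%N.
  rewrite ltn_neqAle; apply/andP; split; last by move: lt_s; case: ifP.
  by case/orP: sij => /eqP ->; rewrite eq_sym.
have csk : climbs c s k.
  apply/and3P; split=> //.
    by apply/forallP => m; apply/implyP => /andP [mk ms]; rewrite s0.
  move: lt_s; rewrite (ltnW sk) sum_leq_split (bigD1 s) //=; lia.
have [kj|jk] := ltnP k j; last first.
  right; exists k; rewrite ltn_neqAle jk andbT; apply/andP; split.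
    by apply: contra_neq nkj => /val_inj.
  by case/orP: sij csk => /eqP -> ->; rewrite ?orbT.
left; apply/R_condP; constructor 2; exists k => //.
(* The choice $s=j$ contradicts $s<k<j$. *)
case/orP: sij csk sk => /eqP -> //; lia.
Qed.

Lemma circuits_reduced_R_cond n (a : 'I_n -> nat) (c : 'I_n -> 'I_n -> nat) :
  (forall i, 0 < a i)%N -> (forall k : 'I_n, (0 < k)%N -> (0 < c k k)%N) ->
  reduces_set (Mset c) (circuit a) ->
  forall i j : 'I_n, (i < j)%N -> (0 < i)%N -> R_cond c i j.
Proof.
(* Induction on $n-j$, so that the conditions with second index above [j] are available. *)
move=> apos cpos red i j; have [d] := ubnP (n - j)%N.
elim: d i j => // d IHd i j led ij i0.
have [//|[k0 Pk0]] := circuit_reduced_R_cond apos cpos red ij.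
have [k /andP [jk /orP ck] kmin] := @arg_minnP _ k0
  (fun k => (j < k)%N && (climbs c i k || climbs c j k)) (fun k => val k) Pk0.
have nclimb (l : 'I_n) : (j < l)%N -> (l < k)%N -> ~~ climbs c i l && ~~ climbs c j l.
  move=> jl lk; rewrite -negb_or; apply: contraTN lk => cl.
  by rewrite -leqNgt; apply: kmin; rewrite jl.
have kn := ltn_ord k.
have ckk : (0 < c k k)%N by apply: cpos; lia.
(* Dominance would read $u_{k,s}+u_{k,k}<2u_{k,k}$, against $u_{k,k}<u_{k,s}$. *)
have notdom (s s' : 'I_n) : climbs c s k -> (s' < k)%N -> s' != s -> ~ dominant c s' k.
  move=> csk s'k s's; have /and3P [_ /forallP/(_ s')] := csk.
  rewrite s'k s's /= => /eqP c0 lt_k; rewrite /dominant (climbs_sum csk) c0; lia.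
have nij : i != j by rewrite neq_ltn ij.
case: ck => ck.
  (* If $u_k$ climbs from [i], use $R_{j,k}$: clause (i) at [j] makes $u_{j,j}$ alone exceed half of
     $\|u_j\|$, clause (ii) contradicts the minimality of [k], and [notdom] excludes clause
     (iii). *)
  have /R_condP [cj|[l cl lk]|dj] : R_cond c j k by apply: IHd => //; lia.
  - apply/R_condP; constructor 3; move: cj; rewrite /contracting /dominant.
    by rewrite sum_leq_split; lia.
  - have [jl _ _] := and3P cl.
    by have := nclimb l jl lk; rewrite cl andbF.
  - by case: (notdom i j ck jk _ dj); rewrite eq_sym.
(* If $u_k$ climbs from [j], use $R_{i,k}$: a climbing index [l] below [j] gives clause (ii), $l=j$
   puts the support of $u_j$ inside $\{i,j\}$, and $l>j$ contradicts minimality. *)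
have /R_condP [ci|[l cl lk]|di] : R_cond c i k by apply: IHd => //; lia.
- by apply/R_condP; constructor 1.
- apply/R_condP; case: (ltngtP l j) => [lj|jl|/val_inj E].
  + by constructor 2; exists l.
  + by have := nclimb l jl lk; rewrite cl.
  + by constructor 3; apply: climbs_dominant; rewrite -?E // E cpos //; lia.
- by case: (notdom j i ck _ nij di); lia.
Qed.

(** * Equivalence of the three properties *)

Theorem theorem4p3 (K : fieldType) (n : nat) (a : 'I_n -> nat)
    (c : 'I_n -> 'I_n -> nat) :
  (2 <= n)%N ->
  (forall i, 0 < a i)%N ->
  (forall i j : 'I_n, val i = 0%N -> val j = 1%N -> (a i < a j)%N) ->
  gluing_first_kind a ->
  (forall k : 'I_n, (0 < k)%N -> (0 < c k k)%N) ->
  @minimal_MarkovBasis K n a (Mset c) ->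
  (distance_reducing a (Mset c) <-> reduces_set (Mset c) (circuit a)) /\
  (reduces_set (Mset c) (circuit a) <->
     (forall i j : 'I_n, (0 < i)%N -> (i < j)%N -> R_cond c i j)).
Proof.
move=> n2 apos a01 _ cpos [markov _].
have dist_circ : distance_reducing a (Mset c) -> reduces_set (Mset c) (circuit a).
  by move=> red z [kz _]; apply: red.
have circ_R : reduces_set (Mset c) (circuit a) ->
    forall i j : 'I_n, (0 < i)%N -> (i < j)%N -> R_cond c i j.
  by move=> red i j i0 ij; apply: (circuits_reduced_R_cond apos cpos red).
have R_dist : (forall i j : 'I_n, (0 < i)%N -> (i < j)%N -> R_cond c i j) ->
    distance_reducing a (Mset c).
  apply: R_cond_distance_reducing; first exact: inKer_uvec_span markov.
  (* [l] is the second index. Its vector climbs from the first index, which serves every [j] beyond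
     [l]; for $j=l$ it is dominant. *)
  move=> i j i0 j0; pose l : 'I_n := Ordinal n2.
  have cil : climbs c i l.
    apply: climbs_first => //; [exact: a01 | exact: cpos | ].
    by case: markov => ker _; apply: ker; exists l.
  have [->|jl] := eqVneq j l; [right; exact: climbs_dominant (cpos _ _) _ | left].
  exists l => //; rewrite ltn_neqAle j0 andbT; apply: contra_neq jl => E.
  by apply: val_inj.
by split; split=> //; [move/circ_R/R_dist | move/R_dist/dist_circ].
Qed.
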